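(* Let $V$ be a 3-dimensional complex vector space with Hermitian form of signature $(2,1)$, identified with $\mathbb C^3$ carrying the Siegel form $H$. Let $\omega,\omega'\in\partial\mathbb{C}\mathrm{H}^2$, let $\phi=\psi_{\omega'}\circ\psi_\omega^{-1}$ be the transition map between the corresponding projective Heisenberg charts on a nonempty finite overlap $\psi_\omega(U_\omega\cap U_{\omega'})$, let $G=g_{\omega'}g_\omega^{-1}$, and let $\rho$ be the nowhere-zero function on the overlap with $\widehat\xi(\phi(p))=\rho(p)\,G\,\widehat\xi(p)$. Then for $p,q$ in the overlap $$K(\phi(p),\phi(q))=\rho(p)\overline{\rho(q)}\,K(p,q).$$ Consequently, boundary cross-ratios are preserved: $X(\phi(a),\phi(b);\phi(c),\phi(d))=X(a,b;c,d)$ whenever the denominator is nonzero; and the Cartan triple product is multiplied by a positive real factor: $$T(\phi(p_1),\phi(p_2),\phi(p_3))=|\rho(p_1)|^2|\rho(p_2)|^2|\rho(p_3)|^2\,T(p_1,p_2,p_3).$$ In particular, the Cartan phase class (the class of $T$ modulo positive real factors) is independent of the chart.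
   Context: Siegel form: $H(Z,W)=Z_0\overline{W_2}+Z_1\overline{W_1}+Z_2\overline{W_0}$ on $\mathbb C^3$. $\partial\mathbb{C}\mathrm{H}^2$ is the set of complex lines $[Z]$ with $Z\neq0$, $H(Z,Z)=0$. A Hermitian-unitary map is an invertible complex-linear map $g$ with $H(gZ,gW)=H(Z,W)$ for all $Z,W$. For $(\zeta,t)\in\mathbb C\times\mathbb R$, $\widehat\xi(\zeta,t)=\left(\frac{-|\zeta|^2+it}{2},\zeta,1\right)$; $\infty=[(1,0,0)]$. For each $\omega\in\partial\mathbb{C}\mathrm{H}^2$ a Hermitian-unitary $g_\omega$ with $g_\omega\omega=\infty$ is chosen, $U_\omega=\partial\mathbb{C}\mathrm{H}^2\setminus\{\omega\}$, and the chart $\psi_\omega:U_\omega\to\mathbb C\times\mathbb R$ is defined by $\psi_\omega([\xi])=(\zeta,t)\iff g_\omega[\xi]=[\widehat\xi(\zeta,t)]$. For $p,q\in\mathbb C\times\mathbb R$: $K(p,q)=H(\widehat\xi(p),\widehat\xi(q))$, $X(a,b;c,d)=\dfrac{K(c,a)K(d,b)}{K(d,a)K(c,b)}$, $T(p_1,p_2,p_3)=-K(p_1,p_2)K(p_2,p_3)K(p_3,p_1)$. *)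

(* Defs.v *)
From HB Require Import structures.
From mathcomp Require Import all_boot all_order all_algebra.
From mathcomp Require Import complex.
From mathcomp Require Import boolp classical_sets functions reals.
From mathcomp Require Import ring lra.
Set Implicit Arguments.
Unset Strict Implicit.
Unset Printing Implicit Defensive.
Import Order.TTheory GRing.Theory Num.Theory.
Local Open Scope classical_set_scope.
Local Open Scope ring_scope.
Local Open Scope complex_scope.

Section Heisenberg.
Variable R : realType.
Local Notation C := R[i].
Local Notation vec := 'cV[C]_3.

Definition herm (Z W : vec) : C :=
  Z 0 0 * (W 2 0)^* + Z 1 0 * (W 1 0)^* + Z 2 0 * (W 0 0)^*.

Definition herm_unitary (g : 'M[C]_3) : Prop :=
  g \in unitmx /\ forall Z W : vec, herm (g *m Z) (g *m W) = herm Z W.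

(* Points of the projective plane are one-dimensional subspaces of C^3. *)
Definition boundary : set {vspace vec} :=
  [set L | exists Z : vec, [/\ Z != 0, herm Z Z = 0 & L = <[Z]>%VS]].

Definition act (g : 'M[C]_3) (L : {vspace vec}) : {vspace vec} :=
  (linfun (mulmx g) @: L)%VS.

Definition bdy_infty : {vspace vec} := <[(delta_mx 0 0)%R : vec]>%VS.

(* hat xi (zeta, t) *)
Definition hxi (p : C * R) : vec :=
  \col_i [:: (- `|p.1| ^+ 2 + 'i%C * p.2%:C) / 2; p.1; 1]`_i.

Definition normalizing (g : {vspace vec} -> 'M[C]_3) : Prop :=
  forall omega, boundary omega ->
    herm_unitary (g omega) /\ act (g omega) omega = bdy_infty.

Definition chart_dom (omega : {vspace vec}) : set {vspace vec} :=
  boundary `\ omega.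

(* Off chart_dom omega the value is irrelevant; on it, chartP below gives
   the characterization by g_omega [xi] = [hat xi (zeta, t)]. *)
Definition chart (g : {vspace vec} -> 'M[C]_3) (omega L : {vspace vec}) :
    C * R :=
  xget (0, 0) [set p | act (g omega) L = <[hxi p]>%VS].

Definition overlap (g : {vspace vec} -> 'M[C]_3) (omega omega' : {vspace vec}) :
    set (C * R) :=
  chart g omega @` (chart_dom omega `&` chart_dom omega').

Definition transition (g : {vspace vec} -> 'M[C]_3)
    (omega omega' : {vspace vec}) : C * R -> C * R :=
  chart g omega' \o 'pinv_(fun=> 0%VS) (chart_dom omega) (chart g omega).

Definition is_multiplier (g : {vspace vec} -> 'M[C]_3)
    (omega omega' : {vspace vec}) (rho : C * R -> C) : Prop :=
  forall p, overlap g omega omega' p ->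
    rho p != 0 /\
    hxi (transition g omega omega' p) =
      rho p *: (g omega' *m invmx (g omega) *m hxi p).

Definition K (p q : C * R) : C := herm (hxi p) (hxi q).

Definition cross_ratio (a b c d : C * R) : C :=
  (K c a * K d b) / (K d a * K c b).

Definition cartan (p1 p2 p3 : C * R) : C := - (K p1 p2 * K p2 p3 * K p3 p1).

(* The class of z modulo multiplication by positive reals. *)
Definition phase_class (z : C) : set C :=
  [set w | exists2 r : R, 0 < r & w = r%:C * z].

Lemma act_line (g : 'M[C]_3) (Z : vec) : act g <[Z]>%VS = <[g *m Z]>%VS.
Proof. by rewrite /act limg_line lfunE. Qed.

Lemma line_eq (Z W : vec) : Z != 0 -> <[Z]>%VS = <[W]>%VS ->
  exists2 c : C, c != 0 & Z = c *: W.
Proof.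
move=> Z0 e; have : Z \in <[W]>%VS by rewrite -e memv_line.
case/vlineP => c ec; exists c => //.
by apply: contraNneq Z0 => c0; rewrite ec c0 scale0r.
Qed.

Lemma line_scale (c : C) (Z : vec) : c != 0 -> <[c *: Z]>%VS = <[Z]>%VS.
Proof.
move=> c0; apply/eqP; rewrite eqEsubv -!memvE.
rewrite memvZ ?memv_line //=.
by apply/vlineP; exists c^-1; rewrite scalerA mulVf // scale1r.
Qed.

Lemma hxi2 (p : C * R) : hxi p 2 0 = 1. Proof. by rewrite mxE. Qed.
Lemma hxi1 (p : C * R) : hxi p 1 0 = p.1. Proof. by rewrite mxE. Qed.
Lemma hxi0 (p : C * R) : hxi p 0 0 = (- `|p.1| ^+ 2 + 'i%C * p.2%:C) / 2.
Proof. by rewrite mxE. Qed.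

Lemma hxi_neq0 (p : C * R) : hxi p != 0.
Proof.
apply/eqP => /(congr1 (fun M : vec => M 2 0)); rewrite hxi2 mxE => /eqP.
by rewrite oner_eq0.
Qed.

Lemma line_hxi_inj (p q : C * R) : <[hxi p]>%VS = <[hxi q]>%VS -> p = q.
Proof.
move=> /(line_eq (hxi_neq0 p)) [c _ e].
have := congr1 (fun M : vec => M 2 0) e; rewrite [RHS]mxE !hxi2 mulr1 => c1.
move: e; rewrite -c1 scale1r => e.
have e1 := congr1 (fun M : vec => M 1 0) e.
have e0 := congr1 (fun M : vec => M 0 0) e.
move: e1 e0; rewrite !hxi1 !hxi0 => e1; rewrite e1.
have h2 : (2 : C)^-1 != 0 by rewrite invr_eq0 pnatr_eq0.
move=> /(mulIf h2) /addrI.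
have hi : ('i : C) != 0 by rewrite eq_complex /= oner_eq0 andbF.
move=> /(mulfI hi) [] e2.
by case: p q e1 e2 {e c1} => [a b] [a' b'] /= -> ->.
Qed.

Lemma vec3P (Z W : vec) :
  Z 0 0 = W 0 0 -> Z 1 0 = W 1 0 -> Z 2 0 = W 2 0 -> Z = W.
Proof.
move=> h0 h1 h2; apply/matrixP => i j; rewrite ord1.
case: i => [[|[|[|//]]] hi].
- by rewrite (_ : Ordinal hi = 0) //; apply: val_inj.
- by rewrite (_ : Ordinal hi = 1) //; apply: val_inj.
- by rewrite (_ : Ordinal hi = 2) //; apply: val_inj.
Qed.

Lemma herm_scale (c : C) (Z W : vec) :
  herm (c *: Z) (c *: W) = c * c^* * herm Z W.
Proof. by rewrite /herm !mxE !rmorphM /=; ring. Qed.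

Lemma null_hxi (Z : vec) : Z != 0 -> herm Z Z = 0 ->
  <[Z]>%VS <> bdy_infty -> exists p, <[Z]>%VS = <[hxi p]>%VS.
Proof.
move=> Z0 HZ Zinf.
have Z2 : Z 2 0 != 0.
  apply/eqP => Z2; apply: Zinf.
  move: HZ; rewrite /herm Z2 rmorph0 mulr0 mul0r add0r addr0 => /eqP.
  rewrite mulf_eq0 conjc_eq0 orbb => /eqP Z1.
  have eZ : Z = Z 0 0 *: delta_mx 0 0.
    by apply: vec3P; rewrite !mxE /= ?mulr1 ?mulr0.
  have Z00 : Z 0 0 != 0.
    by apply: contraNneq Z0 => h; rewrite eZ h scale0r.
  by rewrite {1}eZ line_scale.
pose W : vec := (Z 2 0)^-1 *: Z.
have eW : <[Z]>%VS = <[W]>%VS by rewrite line_scale // invr_eq0.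
have HW : herm W W = 0 by rewrite herm_scale HZ mulr0.
have W2 : W 2 0 = 1 by rewrite mxE mulVf.
exists (W 1 0, 2 * complex.Im (W 0 0)); rewrite eW; congr (<[_]>%VS).
move: HW; rewrite /herm W2 rmorph1 mulr1 mul1r => HW.
apply: vec3P; rewrite ?hxi0 ?hxi1 ?hxi2 //=.
have -> : `|W 1 0| ^+ 2 = W 1 0 * (W 1 0)^* by rewrite normCK.
move: HW; case: (W 0 0) (W 1 0) => [a b] [c d] /=.
move/eqP; rewrite eq_complex /= => /andP[/eqP h1 /eqP h2].
apply: (@mulIf _ (2 : C)); first by rewrite pnatr_eq0.
rewrite divfK ?pnatr_eq0 //; apply/eqP; rewrite eq_complex /=.
by apply/andP; split; apply/eqP; rewrite ?mulr0 ?mul0r ?mulr1 ?addr0; nra.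
Qed.

Lemma act_inj (g : 'M[C]_3) : g \in unitmx -> injective (act g).
Proof.
move=> gu L M e; apply/eqP.
suff h A B : act g A = act g B -> (A <= B)%VS.
  by rewrite eqEsubv (h _ _ e) (h _ _ (esym e)).
move=> {}e; apply/subvP => v vA.
have : linfun (mulmx g) v \in act g B by rewrite -e memv_img.
case/memv_imgP => w wB; rewrite !lfunE /= => /(congr1 (mulmx (invmx g))).
by rewrite !mulKmx // => ->.
Qed.

Lemma chart_ex g omega L : normalizing g -> boundary omega ->
  chart_dom omega L -> exists p, act (g omega) L = <[hxi p]>%VS.
Proof.
move=> hg bo [[Z [Z0 HZ LZ]] Lo].
have [[gu gH] ginf] := hg _ bo.
rewrite LZ act_line; apply: null_hxi.
- apply: contraNneq Z0 => /(congr1 (mulmx (invmx (g omega)))).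
  by rewrite mulKmx // mulmx0 => ->.
- by rewrite gH.
- rewrite -act_line -ginf => /(act_inj gu) e; apply: Lo.
  by rewrite /= LZ.
Qed.

Lemma chartP g omega L p : normalizing g -> boundary omega ->
  chart_dom omega L ->
  chart g omega L = p <-> act (g omega) L = <[hxi p]>%VS.
Proof.
move=> hg bo /(chart_ex hg bo) [q hq].
have hx : act (g omega) L = <[hxi (chart g omega L)]>%VS.
  by rewrite /chart; case: xgetP => //= /(_ q).
split=> [<- //|hp]; apply: line_hxi_inj.
by rewrite -hx.
Qed.

Lemma chart_inj g omega : normalizing g -> boundary omega ->
  {in chart_dom omega &, injective (chart g omega)}.
Proof.
move=> hg bo L M /set_mem LU /set_mem MU e.
have /(chartP _ hg bo LU) hL := e.
have /(chartP _ hg bo MU) hM := erefl (chart g omega M).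
by apply: (@act_inj (g omega)); [case: (hg _ bo) => -[] | rewrite hL hM].
Qed.

Lemma multiplier_exists g omega omega' :
  normalizing g -> boundary omega -> boundary omega' ->
  exists rho, is_multiplier g omega omega' rho.
Proof.
move=> hg bo bo'.
suff /choice[rho hrho] : forall p, exists r : C,
    overlap g omega omega' p -> r != 0 /\
    hxi (transition g omega omega' p) =
      r *: (g omega' *m invmx (g omega) *m hxi p) by exists rho.
move=> p.
have [[L [LU LU'] <-]|nov] := pselect (overlap g omega omega' p); last first.
  by exists 0 => /nov.
rewrite /transition /= pinvKV ?inE //; last exact: chart_inj.
have /(chartP _ hg bo LU) hL := erefl (chart g omega L).
have /(chartP _ hg bo' LU') hL' := erefl (chart g omega' L).
have [[gu _] _] := hg _ bo.
suff e : <[hxi (chart g omega' L)]>%VS =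
         <[g omega' *m invmx (g omega) *m hxi (chart g omega L)]>%VS.
  by have [c c0 ec] := line_eq (hxi_neq0 _) e; exists c.
rewrite -mulmxA -act_line -hL'; congr (act _ _).
by apply: (act_inj gu); rewrite act_line mulKVmx.
Qed.

End Heisenberg.

(* Main.v *)
(** Since the maps g_ω are Hermitian-unitary, so is the linear part G of a
transition map, and sesquilinearity turns the multiplier relation into
K(φp, φq) = ρ(p) conj(ρ(q)) K(p, q).  Every point occurs once in a conjugated
and once in an unconjugated slot of the Cartan triple product, which gives the
factors |ρ|²; in the cross-ratio numerator and denominator pick up the same
factor ρ(c) conj(ρ(a)) ρ(d) conj(ρ(b)). *)
Require Import Defs.
From HB Require Import structures.
From mathcomp Require Import all_boot all_order all_algebra.
From mathcomp Require Import complex.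
From mathcomp Require Import boolp classical_sets functions reals.
From mathcomp Require Import ring.
Set Implicit Arguments.
Unset Strict Implicit.
Unset Printing Implicit Defensive.
Import Order.TTheory GRing.Theory Num.Theory.
Local Open Scope classical_set_scope.
Local Open Scope ring_scope.
Local Open Scope complex_scope.

Section HermitianForm.
Variable R : realType.
Local Notation C := R[i].

Lemma herm_scale2 (c d : C) (Z W : 'cV[C]_3) :
  herm (c *: Z) (d *: W) = c * d^* * herm Z W.
Proof. by rewrite /herm !mxE !rmorphM /=; ring. Qed.

Lemma herm_invmx (g : 'M[C]_3) (Z W : 'cV[C]_3) : herm_unitary g ->
  herm (invmx g *m Z) (invmx g *m W) = herm Z W.
Proof. by case=> gu gH; rewrite -gH !mulKVmx. Qed.

(** The strict order on [R[i]] forces [c] to be a positive real, and multiplication by it permutes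
    the positive reals. *)
Lemma phase_class_scale (c z : C) : 0 < c ->
  phase_class (c * z) = phase_class z.
Proof.
case: c => a b; rewrite ltcE /= => /andP[/eqP-> a0].
apply/seteqP; split=> w [r r0 ->].
  by exists (r * a); [exact: mulr_gt0 | rewrite rmorphM /= mulrA].
(* Absorbing [c] into the real factor sends [r] to [r * a]; this is the inverse substitution. *)
exists (r / a); first exact: divr_gt0.
by rewrite mulrA -[a +i* 0]/(a%:C) -rmorphM /= divfK // gt_eqF.
Qed.

End HermitianForm.

Section Transition.
Variables (R : realType) (g : {vspace 'cV[R[i]]_3} -> 'M[R[i]]_3).
Variables (omega omega' : {vspace 'cV[R[i]]_3}) (rho : R[i] * R -> R[i]).
Hypotheses (hg : normalizing g) (homega : boundary omega).
Hypotheses (homega' : boundary omega') (hrho : is_multiplier g omega omega' rho).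
Local Notation D := (overlap g omega omega').
Local Notation phi := (transition g omega omega').

(** Injectivity of the chart on its domain makes the partial inverse recover [L]. This allows one
    boundary triple to be compared in two charts. *)
Lemma transition_chart L : (chart_dom omega `&` chart_dom omega') L ->
  phi (chart g omega L) = chart g omega' L.
Proof.
by case=> LU _; rewrite /transition /= pinvKV ?inE //; exact: chart_inj.
Qed.

Lemma K_transition p q : D p -> D q ->
  K (phi p) (phi q) = rho p * (rho q)^* * K p q.
Proof.
move=> /hrho[_ ep] /hrho[_ eq].
have [gu _] := hg homega; have [[_ gH'] _] := hg homega'.
(* The two factors of G are removed in turn: first [g omega'], then the inverse of [g omega]. *)
by rewrite /K ep eq herm_scale2 -!mulmxA gH' herm_invmx.
Qed.

Lemma cross_ratio_transition a b c d : D a -> D b -> D c -> D d ->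
  cross_ratio (phi a) (phi b) (phi c) (phi d) = cross_ratio a b c d.
Proof.
move=> Da Db Dc Dd; rewrite /cross_ratio !K_transition //.
have rho0 p : D p -> rho p != 0 by case/hrho.
have rhoC0 p : D p -> (rho p)^* != 0 by move=> Dp; rewrite conjc_eq0 rho0.
(* Multipliers are gathered apart from kernels in numerator and denominator, so that their common
   nonzero factor splits off as a quotient equal to 1. *)
rewrite ![_ * K _ _ * _]mulrACA.
rewrite (_ : rho d * _ * _ = rho c * (rho a)^* * (rho d * (rho b)^*)).
  by rewrite -mulf_div divff ?mul1r // !mulf_neq0 ?rho0 ?rhoC0.
by ring.
Qed.

Lemma cartan_transition p1 p2 p3 : D p1 -> D p2 -> D p3 ->
  cartan (phi p1) (phi p2) (phi p3) =
    `|rho p1| ^+ 2 * `|rho p2| ^+ 2 * `|rho p3| ^+ 2 * cartan p1 p2 p3.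
Proof.
move=> D1 D2 D3; rewrite /cartan !K_transition //.
(* Writing squared moduli as products with conjugates leaves a polynomial identity. *)
have normE z : `|z| ^+ 2 = z * z^* :> R[i] by rewrite normCK.
by rewrite !normE; ring.
Qed.

(** Nonvanishing of [rho] on the overlap makes the factor strictly positive, as [phase_class_scale]
    requires. *)
Lemma multiplier_norm_gt0 p1 p2 p3 : D p1 -> D p2 -> D p3 ->
  0 < `|rho p1| ^+ 2 * `|rho p2| ^+ 2 * `|rho p3| ^+ 2.
Proof.
by move=> /hrho[r1 _] /hrho[r2 _] /hrho[r3 _];
  rewrite !mulr_gt0 ?exprn_gt0 ?normr_gt0.
Qed.

End Transition.

Theorem corollary17p5 (R : realType)
    (g : {vspace 'cV[R[i]]_3} -> 'M[R[i]]_3) (hg : normalizing g)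
    (omega omega' : {vspace 'cV[R[i]]_3})
    (homega : boundary omega) (homega' : boundary omega')
    (hne : overlap g omega omega' !=set0)
    (rho : R[i] * R -> R[i]) (hrho : is_multiplier g omega omega' rho) :
  let D := overlap g omega omega' in
  let phi := transition g omega omega' in
  [/\ (forall p q, D p -> D q ->
         K (phi p) (phi q) = rho p * (rho q)^* * K p q),
      (forall a b c d, D a -> D b -> D c -> D d ->
         K d a * K c b != 0 ->
         cross_ratio (phi a) (phi b) (phi c) (phi d) = cross_ratio a b c d),
      (forall p1 p2 p3, D p1 -> D p2 -> D p3 ->
         0 < `|rho p1| ^+ 2 * `|rho p2| ^+ 2 * `|rho p3| ^+ 2 /\
         cartan (phi p1) (phi p2) (phi p3) =
           `|rho p1| ^+ 2 * `|rho p2| ^+ 2 * `|rho p3| ^+ 2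
             * cartan p1 p2 p3)
    & (forall L1 L2 L3 : {vspace 'cV[R[i]]_3},
         (chart_dom omega `&` chart_dom omega') L1 ->
         (chart_dom omega `&` chart_dom omega') L2 ->
         (chart_dom omega `&` chart_dom omega') L3 ->
         phase_class
           (cartan (chart g omega' L1) (chart g omega' L2) (chart g omega' L3))
         = phase_class
           (cartan (chart g omega L1) (chart g omega L2) (chart g omega L3)))].
Proof.
move=> D phi; split.
- by move=> p q; exact: K_transition.
- move=> a b c d Da Db Dc Dd _.
  exact: (cross_ratio_transition hg homega homega' hrho).
- move=> p1 p2 p3 D1 D2 D3.
  split; [exact: (multiplier_norm_gt0 hrho) |].
  exact: (cartan_transition hg homega homega' hrho).
- move=> L1 L2 L3 U1 U2 U3.
  have DL L : (chart_dom omega `&` chart_dom omega') L -> D (chart g omega L).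
    by move=> UL; exists L.
  (* The [omega'] coordinates become images under [phi] of the [omega] coordinates, so the scaling
     law for the triple product applies. *)
  rewrite -(transition_chart hg homega U1) -(transition_chart hg homega U2).
  rewrite -(transition_chart hg homega U3).
  rewrite (cartan_transition hg homega homega' hrho); try exact: DL.
  by apply: phase_class_scale; apply: (multiplier_norm_gt0 hrho); exact: DL.
Qed.
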